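(* Let $K$ be a field and let $L$ be a finite modular lattice. Then $L$ is distributive if and only if $H[L]=K[L]/I_L$ admits a combinatorial Koszul filtration.
   Context: $K[L]$ denotes the polynomial ring over $K$ whose variables are the elements of $L$. For incomparable $a,b\in L$, the binomial $ab-(a\vee b)(a\wedge b)$ is called a basic binomial; $I_L$ is the ideal of $K[L]$ generated by all basic binomials, and $H[L]=K[L]/I_L$, standard graded with $\deg(a)=1$ for each $a\in L$. A lattice is modular if $x\le b$ implies $x\vee(a\wedge b)=(x\vee a)\wedge b$ for all $x,a,b$. For a standard graded $K$-algebra $R$ with maximal graded ideal $\mathfrak m$, a collection $\mathcal F$ of ideals of $R$ is a Koszul filtration if: (i) every ideal in $\mathcal F$ is generated by linear forms; (ii) $0$ and $\mathfrak m$ belong to $\mathcal F$; (iii) for every ideal $0\ne I\in\mathcal F$ there exists $J\in\mathcal F$ with $J\subset I$, $I/J$ cyclic, and $J:I\in\mathcal F$. A Koszul filtration of $H[L]$ is called combinatorial if every ideal in it is generated by residue classes $a+I_L$ of some elements $a\in L$ (i.e., of variables). *)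

(* Defs.v *)
From HB Require Import structures.
From mathcomp Require Import all_boot all_order all_algebra.
From mathcomp Require Import mpoly.

Set Implicit Arguments.
Unset Strict Implicit.
Unset Printing Implicit Defensive.

Import Order.Theory GRing.Theory.
Local Open Scope ring_scope.

Definition modular_lattice d (L : latticeType d) : Prop :=
  forall x a b : L, (x <= b)%O -> (x `|` (a `&` b))%O = ((x `|` a) `&` b)%O.

Definition distributive_lattice d (L : latticeType d) : Prop :=
  forall a b c : L, (a `&` (b `|` c))%O = ((a `&` b) `|` (a `&` c))%O.

Section Ideals.
Variable R : comRingType.

Definition ideal_gen (G : R -> Prop) : R -> Prop :=
  fun f => exists s : seq (R * R),
    (forall p, p \in s -> G p.2) /\ f = \sum_(p <- s) p.1 * p.2.

Definition same_ideal (I J : R -> Prop) : Prop := forall x, I x <-> J x.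

Definition sub_ideal (J I : R -> Prop) : Prop := forall x, J x -> I x.

Definition colon_ideal (J I : R -> Prop) : R -> Prop :=
  fun r => forall x, I x -> J (r * x).

Definition cyclic_quotient (I J : R -> Prop) : Prop :=
  exists2 g, I g & forall x, I x -> exists r, J (x - r * g).

Definition zero_ideal : R -> Prop := fun r => r = 0.

End Ideals.

Section Hibi.
Variables (K : fieldType) (d : Order.disp_t) (L : finLatticeType d).

(* K[L]: polynomial ring whose variables are the elements of L,
   realised as {mpoly K[#|L|]} with the variable of a : L being
   'X_(enum_rank a). *)
Definition KL := {mpoly K[#|L|]}.

Definition var (a : L) : KL := 'X_(enum_rank a).

Definition basic_binomial (f : KL) : Prop :=
  exists a b : L, (a >< b)%O /\
    f = var a * var b - var (a `|` b)%O * var (a `&` b)%O.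

Definition hibi_ideal : KL -> Prop := ideal_gen (@basic_binomial).

(* pi : K[L] -> R presents R as the quotient H[L] = K[L]/I_L:
   pi is a surjective ring morphism with kernel exactly I_L. *)
Definition hibi_presentation (R : comRingType) (pi : {rmorphism KL -> R}) : Prop :=
  (forall y : R, exists f : KL, pi f = y) /\
  (forall f : KL, pi f = 0 <-> hibi_ideal f).

Variables (R : comRingType) (pi : {rmorphism KL -> R}).

(* linear forms of R = K[L]/I_L: images of homogeneous degree-1 polynomials
   (the grading on R is the one induced by deg(a) = 1) *)
Definition linear_form (r : R) : Prop :=
  exists2 p : KL, p \is 1.-homog & r = pi p.

Definition max_graded_ideal : R -> Prop := ideal_gen linear_form.

Definition var_ideal (S : {set L}) : R -> Prop :=
  ideal_gen (fun r => exists2 a, a \in S & r = pi (var a)).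

Definition in_family (F : (R -> Prop) -> Prop) (I : R -> Prop) : Prop :=
  exists2 J, F J & same_ideal J I.

Definition koszul_filtration (F : (R -> Prop) -> Prop) : Prop :=
  [/\
      (forall I, F I -> exists G : R -> Prop,
          (forall r, G r -> linear_form r) /\ same_ideal I (ideal_gen G)),
      in_family F (@zero_ideal R),
      in_family F max_graded_ideal &
      (forall I, F I -> ~ same_ideal I (@zero_ideal R) ->
         exists2 J, F J &
           [/\ sub_ideal J I, cyclic_quotient I J &
               in_family F (colon_ideal J I)])].

Definition combinatorial_koszul_filtration (F : (R -> Prop) -> Prop) : Prop :=
  koszul_filtration F /\
  (forall I, F I -> exists S : {set L}, same_ideal I (var_ideal S)).

End Hibi.

(* Main.v *)
Require Import Defs.
From HB Require Import structures.
From mathcomp Require Import all_boot all_order all_algebra.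
From mathcomp Require Import mpoly.

(* If L is distributive, the ideals generated by the down-sets of L form a
   Koszul filtration: when a is maximal in the down-set S, the colon ideal
   (S \ a) : a is P_a = (c : c not >= a).  The inclusion of P_a is clear, since
   a c = (a v c)(a ^ c).  Conversely, the monomial map sending c to 0 if c is not
   >= a, and to the product of the variables x_p over the join-prime p <= c
   otherwise, has values in a domain, does not kill a, and its kernel is
   I_L + P_a, because two products of variables with the same join-prime counts
   are equal in H[L].

   If L is modular but not distributive, some interval [u, v] contains an
   element with two complements; take [u, v] minimal, so that it has length 2.
   In a combinatorial Koszul filtration, consider the step J = (S') of I = (S)
   where an element b of [u, v] is adjoined for the first time.  The K-algebra
   maps H[L] -> K that send the elements of an interval to 1 and the other ones
   to 0 show that no element of [u, v] lies in the colon ideal J : b.  But b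
   satisfies a binomial relation b m = b m' with m <> m' supported in [u, v],
   which puts such an element into any ideal generated by variables and equal
   to J : b. *)

Set Implicit Arguments.
Unset Strict Implicit.
Unset Printing Implicit Defensive.

Import Order.Theory GRing.Theory.

(* Whitman's algorithm, with the hypotheses as generating inequalities. *)
Ltac lattice_le := solve
  [ assumption | exact: lexx
  | rewrite leUx; apply/andP; split; lattice_le
  | rewrite lexI; apply/andP; split; lattice_le
  | apply: lexUl; lattice_le | apply: lexUr; lattice_le
  | apply: leIxl; lattice_le | apply: leIxr; lattice_le ].

(** * Relative complements and diamonds in modular lattices *)

Section RelativeComplements.
Local Open Scope order_scope.

Definition rel_compl d (L : latticeType d) (u v a x : L) : Prop :=
  a `&` x = u /\ a `|` x = v.

Definition two_compl d (L : latticeType d) (u v : L) : Prop :=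
  exists a x y, [/\ x <> y, rel_compl u v a x & rel_compl u v a y].

Definition minimal_two_compl d (L : latticeType d) (u v : L) : Prop :=
  two_compl u v /\
  forall p q, u <= p -> q <= v -> two_compl p q -> p = u /\ q = v.

Lemma rel_complC d (L : latticeType d) (u v a x : L) :
  rel_compl u v a x -> rel_compl u v x a.
Proof. by case=> h k; split; rewrite (meetC, joinC). Qed.

Lemma rel_compl_bounds d (L : latticeType d) (u v a x : L) :
  rel_compl u v a x -> [/\ u <= a, a <= v, u <= x & x <= v].
Proof.
by case=> <- <-; split; rewrite ?leIl ?leIr ?leUl ?leUr.
Qed.

Lemma modular_dual d (L : latticeType d) :
  modular_lattice L -> modular_lattice L^d.
Proof.
move=> mL.
suff h (x a b : L) : b <= x -> x `&` (a `|` b) = (x `&` a) `|` b by [].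
by move=> bx; rewrite meetC joinC -mL // joinC meetC.
Qed.

Lemma two_compl_dual d (L : latticeType d) (u v : L) :
  two_compl u v -> two_compl (v : L^d) u.
Proof. by case=> a [x [y [xy [h1 h2] [h3 h4]]]]; exists a, x, y. Qed.

Lemma minimal_two_compl_dual d (L : latticeType d) (u v : L) :
  minimal_two_compl u v -> minimal_two_compl (v : L^d) u.
Proof.
case=> h hmin; split=> [|p q hp hq hpq]; first exact: two_compl_dual.
by case: (hmin q p hq hp (two_compl_dual hpq)).
Qed.

Section ModularMedian.
Context d (L : latticeType d).
Hypothesis modL : modular_lattice L.
Implicit Types a b c e p q u v x y z : L.

(** There is no pentagon in a modular lattice: the modular law for [x <= y] equates the join of [x]
    with [a ^ y = u], which is [x], and the meet of [x v a = a v y] with [y], which is [y]. *)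
Lemma rel_compl_le_eq u v a x y :
  rel_compl u v a x -> rel_compl u v a y -> x <= y -> x = y.
Proof.
move=> [h1 h2] [h3 h4] xy.
by have := modL a xy; rewrite h3 -h1 meetKUC [x `|` a]joinC h2 -h4 joinIK.
Qed.

(** One use of the modular law reduces the claim to bounding [a ^ (b v (a ^ c))] by [p]; a second
    one turns that element into [(a ^ b) v (a ^ c)]. *)
Lemma median_meet a b c p e :
  a `&` b <= p -> a `&` c <= p -> p <= b `|` (a `&` c) ->
  ((a `&` e) `|` p) `&` ((b `&` e) `|` p) = p.
Proof.
move=> abp acp pb; rewrite joinC -modL ?leUr //; apply/join_idPl.
apply: le_trans (_ : a `&` (b `|` a `&` c) <= _).
  rewrite leI2 ?leIl // leUx pb andbT.
  by apply: le_trans (leUl _ _); rewrite leIl.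
by rewrite joinC meetC -modL ?leIl // leUx acp meetC.
Qed.

End ModularMedian.

Lemma median_join d (L : latticeType d) (a b c p e : L) :
  modular_lattice L ->
  e <= a `|` b -> e <= a `|` c -> b `&` (a `|` c) <= e ->
  ((a `|` p) `&` e) `|` ((b `|` p) `&` e) = e.
Proof. by move=> /modular_dual mL; exact: (@median_meet _ L^d mL a b c e p). Qed.

Section ModularDiamond.
Context d (L : latticeType d).
Hypothesis modL : modular_lattice L.
Implicit Types a b c e p q u v x y z : L.

(* The median construction of the free modular lattice on three generators. *)
Lemma nondistributive_two_compl a b c :
  a `&` (b `|` c) <> (a `&` b) `|` (a `&` c) -> exists u v, two_compl u v.
Proof.
move=> nd.
pose p := (a `&` b) `|` (a `&` c) `|` (b `&` c).
pose e := (a `|` b) `&` (a `|` c) `&` (b `|` c).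
have [p1 p2 p3] : [/\ a `&` b <= p, a `&` c <= p & b `&` c <= p].
  by split; rewrite /p; lattice_le.
have [e1 e2 e3] : [/\ e <= a `|` b, e <= a `|` c & e <= b `|` c].
  by split; rewrite /e; lattice_le.
have pe : p <= e.
  by rewrite /p /e; lattice_le.
have sw x : (x `|` p) `&` e = (x `&` e) `|` p.
  by rewrite [x `|` p]joinC -modL // joinC.
have [ma mb mc] : [/\ p <= a `|` (b `&` c), p <= b `|` (a `&` c) &
                      p <= c `|` (a `&` b)].
  by split; rewrite /p; lattice_le.
have [ja jb jc] : [/\ a `&` (b `|` c) <= e, b `&` (a `|` c) <= e &
                      c `&` (a `|` b) <= e].
  by split; rewrite /e; lattice_le.
(* The images of [a], [b], [c] under [f] are pairwise complementary between the lower median [p] and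
   the upper median [e]. *)
exists p, e; pose f x := (x `&` e) `|` p.
have cab : rel_compl p e (f a) (f b).
  split; first exact: (median_meet modL _ p1 p2).
  by rewrite /f -!sw (median_join _ modL e1 e2).
have cac : rel_compl p e (f a) (f c).
  split; first exact: (median_meet modL _ p2 p1).
  by rewrite /f -!sw (median_join _ modL e2 e1).
have cbc : rel_compl p e (f b) (f c).
  split.
    by apply: (median_meet modL (c := a)) => //; rewrite [b `&` a]meetC.
  by rewrite /f -!sw (median_join (c := a) _ modL) // [b `|` a]joinC.
(* If two images agree, the medians coincide, and [a ^ (b v c) = a ^ e = a ^ p] collapses to
   [(a ^ b) v (a ^ c)]. *)
exists (f a), (f b), (f c); split=> // fbc; apply: nd.
have ep : e = p by case: cbc => <- <-; rewrite fbc meetxx joinxx.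
have -> : a `&` (b `|` c) = a `&` e.
  by apply/le_anti/andP; split; lattice_le.
rewrite ep /p meetC -modL; last by rewrite leUx !leIl.
apply/join_idPl; rewrite -meetA [c `&` a]meetC.
by rewrite leIxr // leUr.
Qed.

(** By modularity, the projection of [a] into the interval from [x ^ y] to [x v y] is a complement
    of both [x] and [y] there. *)
Lemma two_compl_diamond u v a x y :
  x <> y -> rel_compl u v a x -> rel_compl u v a y ->
  two_compl (x `&` y) (x `|` y).
Proof.
move=> xy [h1 h2] [h3 h4].
have [ux xv] : u <= x /\ x <= v by rewrite -h1 -h2 leIr leUr.
have [uy yv] : u <= y /\ y <= v by rewrite -h3 -h4 leIr leUr.
have le : x `&` y <= x `|` y by lattice_le.
have side t : x `&` y <= t -> t <= x `|` y -> rel_compl u v a t ->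
    rel_compl (x `&` y) (x `|` y) ((x `&` y) `|` (a `&` (x `|` y))) t.
  move=> lt tl [k1 k2]; split.
    rewrite modL // -meetA (meet_idPr tl) -modL // k1.
    by apply/join_idPl; lattice_le.
  rewrite joinAC (join_idPr lt) modL // [t `|` a]joinC k2.
  by apply/meet_idPr; lattice_le.
exists ((x `&` y) `|` (a `&` (x `|` y))), x, y.
by split=> //; apply: side => //; lattice_le.
Qed.

(* By modularity [e] has the two complements [(e v z) ^ y] and [(e v y) ^ z]
   in a smaller interval with the same bottom [u]. *)
Lemma minimal_diamond_atom u v x y z e :
  minimal_two_compl u v ->
  rel_compl u v x y -> rel_compl u v x z -> rel_compl u v y z ->
  u <= e -> e <= x -> e = u \/ e = x.
Proof.
move=> [_ hmin] cxy cxz cyz ue ex.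
case: (eqVneq e u) => [->|eu]; [by left|right].
have [ux xv uy yv] := rel_compl_bounds cxy.
have [_ _ uz zv] := rel_compl_bounds cxz.
have ev := le_trans ex xv.
pose f := (e `|` z) `&` y; pose g := (e `|` y) `&` z.
have ef : e `|` f = (e `|` z) `&` (e `|` y).
  by rewrite /f [in LHS]meetC modL ?leUl // meetC.
have eg : e `|` g = (e `|` z) `&` (e `|` y).
  by rewrite /g [in LHS]meetC modL ?leUl.
have mf : e `&` f = u.
  apply/le_anti; rewrite -{1}(proj1 cxy); apply/andP; split; rewrite /f; lattice_le.
have mg : e `&` g = u.
  apply/le_anti; rewrite -{1}(proj1 cxz); apply/andP; split; rewrite /g; lattice_le.
(* If [f = g], this element lies below [y ^ z = u]; modularity then gives [e <= z], hence
   [e <= x ^ z = u]. *)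
have fg : f <> g.
  move=> fg; have fu : f <= u.
    by rewrite -(proj1 cyz) lexI {1}/f {1}fg /g !leIr.
  have ez : e `|` z <= z.
    have yf : y `&` (e `|` z) <= z by rewrite meetC; apply: le_trans fu uz.
    apply: le_trans (_ : (z `|` y) `&` (e `|` z) <= _); last first.
      by rewrite -modL; lattice_le.
    by rewrite [z `|` y]joinC (proj2 cyz); lattice_le.
  case/negP: eu; apply/eqP/le_anti; rewrite ue andbT -(proj1 cxz).
  have ez' : e <= z by apply: le_trans ez; lattice_le.
  by lattice_le.
have [_ fv] : u = u /\ e `|` f = v.
  apply: hmin => //; first by rewrite /f; lattice_le.
  by exists e, f, g; split=> //; split=> //; rewrite ef eg.
(* By modularity the left side is [e v (f ^ x)], and [f ^ x <= y ^ x = u]. *)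
have : (e `|` f) `&` x = e.
  rewrite -modL //; apply/join_idPl.
  apply: le_trans ue; rewrite -(proj1 cxy) /f; lattice_le.
by rewrite fv => <-; apply/meet_idPr.
Qed.

End ModularDiamond.

Lemma minimal_diamond_coatom d (L : latticeType d) (u v x y z e : L) :
  modular_lattice L -> minimal_two_compl u v ->
  rel_compl u v x y -> rel_compl u v x z -> rel_compl u v y z ->
  x <= e -> e <= v -> e = v \/ e = x.
Proof.
move=> /modular_dual mL /minimal_two_compl_dual hmin [a1 a2] [b1 b2] [c1 c2] xe ev.
by apply: (@minimal_diamond_atom _ L^d mL v u x y z e).
Qed.

Section MinimalInterval.
Context d (L : latticeType d).
Hypothesis modL : modular_lattice L.
Implicit Types a b c e p q u v x y z : L.

(** By minimality, the diamond spanned by two complements [x], [y] of [a] fills the whole interval,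
    so [x] and [y] are complements of each other. *)
Lemma minimal_two_compl_diamond u v : minimal_two_compl u v ->
  exists x y z, [/\ x <> y, rel_compl u v x y, rel_compl u v x z & rel_compl u v y z].
Proof.
move=> [[a [x [y [xy cx cy]]]] hmin].
have [_ _ ux xv] := rel_compl_bounds cx; have [_ _ uy yv] := rel_compl_bounds cy.
have [] := hmin _ _ _ _ (two_compl_diamond modL xy cx cy); [lattice_le|lattice_le|].
by move=> h1 h2; exists x, y, a; split=> //; apply: rel_complC.
Qed.

(** Each [p] among [x], [y], [z] is both an atom and a coatom of the interval, so [b] is equal to
    [p] or a complement of [p]. In every case two of the three are complements of [b]. *)
Lemma minimal_two_compl_inner u v b : minimal_two_compl u v ->
  u < b -> b < v -> exists y z, [/\ y <> z, rel_compl u v b y & rel_compl u v b z].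
Proof.
move=> hm ub bv; have [x [y [z [xy cxy cxz cyz]]]] := minimal_two_compl_diamond hm.
have key p q r : rel_compl u v p q -> rel_compl u v p r -> rel_compl u v q r ->
    b = p \/ rel_compl u v b p.
  move=> c1 c2 c3; have [up pv _ _] := rel_compl_bounds c1.
  have ub' := ltW ub; have bv' := ltW bv.
  case: (minimal_diamond_atom (e := b `&` p) modL hm c1 c2 c3) => [||h1|h1];
    try lattice_le.
    case: (minimal_diamond_coatom (e := b `|` p) modL hm c1 c2 c3) =>
      [||h2|h2]; try lattice_le.
      by right.
    move/join_idPr/meet_idPl: h2; rewrite h1 => h.
    by rewrite h ltxx in ub.
  move/meet_idPr: h1 => pb.
  case: (minimal_diamond_coatom (e := b) modL hm c1 c2 c3) => // [h|->]; last by left.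
  by rewrite h ltxx in bv.
have cyx := rel_complC cxy; have czx := rel_complC cxz; have czy := rel_complC cyz.
have xz : x <> z.
  move=> h; move: cxz ub bv; rewrite h => -[]; rewrite meetxx joinxx => <- <- zb bz.
  by have := lt_trans zb bz; rewrite ltxx.
have yz : y <> z.
  move=> h; move: cyz ub bv; rewrite h => -[]; rewrite meetxx joinxx => <- <- zb bz.
  by have := lt_trans zb bz; rewrite ltxx.
case: (key _ _ _ cxy cxz cyz) => [->|bx]; first by exists y, z.
case: (key _ _ _ cyx cyz cxz) => [->|bY]; first by exists x, z.
by exists x, y.
Qed.
End MinimalInterval.

(** An interval with the fewest elements is minimal for inclusion. *)
Lemma exists_minimal_two_compl d (L : finLatticeType d) (u v : L) :
  two_compl u v -> exists p q : L, minimal_two_compl p q.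
Proof.
pose I (w : L * L) := [set c | w.1 <= c <= w.2].
pose P (w : L * L) := [exists t : L * L * L, [&& t.1.2 != t.2,
  t.1.1 `&` t.1.2 == w.1, t.1.1 `|` t.1.2 == w.2,
  t.1.1 `&` t.2 == w.1 & t.1.1 `|` t.2 == w.2]].
have PP w : reflect (two_compl w.1 w.2) (P w).
  apply: (iffP existsP) => [[[[a x] y] /=]|[a [x [y [xy [h1 h2] [h3 h4]]]]]].
    case/and5P=> /eqP xy /eqP h1 /eqP h2 /eqP h3 /eqP h4.
    by exists a, x, y.
  by exists (a, x, y) => /=; rewrite h1 h2 h3 h4 !eqxx !andbT; apply/eqP.
move=> h; have P0 : P (u, v) by apply/PP.
case: (arg_minnP (fun w => #|I w|) P0) => -[p q] /PP /= Ppq hmin.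
exists p, q; split=> // p' q' pp qq c.
have le : p' <= q'.
  case: c => a [x [y [_ [<- <-] _]]]; lattice_le.
have sub : I (p', q') \subset I (p, q).
  apply/subsetP=> z; rewrite !inE /= => /andP[h1 h2].
  by rewrite (le_trans pp h1) (le_trans h2 qq).
have /eqP e : I (p', q') == I (p, q) by rewrite eqEcard sub hmin //; apply/PP.
have pq : p <= q by apply: le_trans pp (le_trans le qq).
have : p \in I (p', q') by rewrite e inE /= lexx pq.
have : q \in I (p', q') by rewrite e inE /= lexx pq.
rewrite !inE /= => /andP[_ h1] /andP[h2 _].
by split; apply/le_anti; rewrite ?pp ?qq ?h1 ?h2.
Qed.

End RelativeComplements.

Local Open Scope ring_scope.

(** * Ideals given by generators *)

Section IdealGen.
Variable R : comNzRingType.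
Implicit Types (G I J : R -> Prop) (r s : R).

Lemma ideal_gen_ind G (P : R -> Prop) :
  P 0 -> (forall r s, P r -> P s -> P (r + s)) ->
  (forall r g, G g -> P (r * g)) -> forall r, ideal_gen G r -> P r.
Proof.
move=> P0 PD PM _ [s [sG ->]]; elim: s sG => [|p s IH] sG; first by rewrite big_nil.
rewrite big_cons; apply: PD; first by apply/PM/sG; rewrite mem_head.
by apply: IH => q qs; apply: sG; rewrite inE qs orbT.
Qed.

Lemma ideal_gen0 G : ideal_gen G 0.
Proof. by exists [::]; rewrite big_nil. Qed.

Lemma ideal_genD G r s : ideal_gen G r -> ideal_gen G s -> ideal_gen G (r + s).
Proof.
move=> [a [aG ->]] [b [bG ->]]; exists (a ++ b); rewrite big_cat; split=> // p.
by rewrite mem_cat => /orP[/aG|/bG].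
Qed.

Lemma ideal_gen_mulg G r g : G g -> ideal_gen G (r * g).
Proof.
by exists [:: (r, g)]; rewrite big_seq1; split=> // p; rewrite inE => /eqP->.
Qed.

Lemma ideal_gen_mem G g : G g -> ideal_gen G g.
Proof. by rewrite -[g in ideal_gen _ g]mul1r; exact: ideal_gen_mulg. Qed.

Lemma ideal_genM G r s : ideal_gen G s -> ideal_gen G (r * s).
Proof.
move: s; apply: ideal_gen_ind => [|s t|s g Gg].
- by rewrite mulr0; exact: ideal_gen0.
- by rewrite mulrDr; exact: ideal_genD.
- by rewrite mulrA; exact: ideal_gen_mulg.
Qed.

Lemma ideal_gen_sub G H r :
  (forall g, G g -> ideal_gen H g) -> ideal_gen G r -> ideal_gen H r.
Proof.
move=> GH; move: r; apply: ideal_gen_ind => [|r s|r g /GH].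
- exact: ideal_gen0.
- exact: ideal_genD.
- exact: ideal_genM.
Qed.

Lemma ideal_gen_sum G (T : eqType) (s : seq T) (P : pred T) (F : T -> R) :
  (forall t, t \in s -> P t -> ideal_gen G (F t)) ->
  ideal_gen G (\sum_(t <- s | P t) F t).
Proof.
move=> h; rewrite big_seq_cond; apply: big_ind => [|r t|t /andP[]].
- exact: ideal_gen0.
- exact: ideal_genD.
- exact: h.
Qed.

End IdealGen.

(** * Evaluations of H[L] and ideals generated by variables *)

Section HibiRing.
Variables (K : fieldType) (d : Order.disp_t) (L : finLatticeType d).
Implicit Types (f g h : KL K L) (a b c u v w t x y z : L) (S T : {set L}).

Local Notation var := (@var K d L).

Definition interval_eval u v : KL K L -> K :=
  meval (fun i => (u <= enum_val i <= v)%O%:R).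
HB.instance Definition _ u v := GRing.RMorphism.on (interval_eval u v).

Lemma interval_eval_var u v a : interval_eval u v (var a) = (u <= a <= v)%O%:R.
Proof. by rewrite /interval_eval mevalXU enum_rankK. Qed.

(** Two elements both lie in an interval exactly when their meet and join both do. *)
Lemma interval_eval_binomial u v f : basic_binomial f -> interval_eval u v f = 0.
Proof.
move=> [a [b [_ ->]]]; rewrite rmorphB !rmorphM /= !interval_eval_var -!natrM.
rewrite !mulnb lexI leUx; apply/eqP; rewrite subr_eq0; apply/eqP; congr (_%:R).
congr nat_of_bool; apply/idP/idP.
  case/andP=> /andP[h1 h2] /andP[h3 h4].
  by rewrite h1 h2 h3 h4 (le_trans h1 (leUl _ _)) (le_trans (leIl _ _) h2).
case/andP=> /and3P[h1 h2 h3] /andP[/andP[h4 h5] h6].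
by rewrite h2 h3 h4 h5.
Qed.

(** The coefficient of the variable [c], taken as a derivative at the origin so that products are
    handled by the Leibniz rule. *)
Definition lin_coef c f : K := meval (fun=> 0) f^`M(enum_rank c).

Lemma lin_coefM c f g :
  lin_coef c (f * g) =
    lin_coef c f * meval (fun=> 0) g + meval (fun=> 0) f * lin_coef c g.
Proof. by rewrite /lin_coef mderivM mevalD !mevalM. Qed.

Lemma lin_coefD c f g : lin_coef c (f + g) = lin_coef c f + lin_coef c g.
Proof. by rewrite /lin_coef mderivD mevalD. Qed.

Lemma lin_coefB c f g : lin_coef c (f - g) = lin_coef c f - lin_coef c g.
Proof. by rewrite /lin_coef mderivB mevalB. Qed.

Lemma lin_coef_var c a : lin_coef c (var a) = (a == c)%:R.
Proof.
rewrite /lin_coef /Defs.var mderivX mnm1E (inj_eq enum_rank_inj) mevalZ.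
case: (eqVneq a c) => [->|_]; last by rewrite mul0r.
have -> : (U_(enum_rank c) - U_(enum_rank c) = 0 :> 'X_{1..#|L|})%MM.
  by apply/mnmP=> i; rewrite mnmBE mnm0E subnn.
by rewrite mpolyX0 meval1 mulr1.
Qed.

Lemma meval0_var a : meval (fun=> 0) (var a) = 0.
Proof. by rewrite mevalXU. Qed.

Variables (R : comNzRingType) (pi : {rmorphism KL K L -> R}).
Hypothesis pres : hibi_presentation pi.

Lemma pi_join_meet a b :
  pi (var a) * pi (var b) = pi (var (a `|` b)%O) * pi (var (a `&` b)%O).
Proof.
have [|inc] := boolP (a >=< b)%O.
  case/orP=> h; last by rewrite (meet_idPr h) (join_idPl h).
  by rewrite (meet_idPl h) (join_idPr h) mulrC.
apply/eqP; rewrite -subr_eq0 -!rmorphM -rmorphB; apply/eqP.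
by apply/(proj2 pres)/ideal_gen_mem; exists a, b.
Qed.

(** Evaluations are defined on K[L] only, so membership is lifted there. Lifting generator by
    generator leaves an error in the kernel of [pi], which the binomials generate. *)
Lemma var_ideal_lift S f : var_ideal pi S (pi f) ->
  ideal_gen (fun g => basic_binomial g \/ exists2 a, a \in S & g = var a) f.
Proof.
set G := (X in ideal_gen X).
suff lift r : var_ideal pi S r -> exists2 g, ideal_gen G g & pi g = r.
  case/lift=> g Gg /eqP; rewrite eq_sym -subr_eq0 -rmorphB => /eqP.
  move/(proj2 pres) => /ideal_gen_sub h.
  rewrite -[f](subrK g); apply: ideal_genD => //; apply: h => e he.
  by apply: ideal_gen_mem; left.
move: r; apply: ideal_gen_ind => [|r s [g Gg <-] [h Gh <-]|r g [a aS ->]].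
- by exists 0; [exact: ideal_gen0|exact: rmorph0].
- by exists (g + h); [exact: ideal_genD|exact: rmorphD].
- have [h <-] := proj1 pres r; exists (h * var a); last exact: rmorphM.
  by apply: ideal_gen_mulg; right; exists a.
Qed.

Lemma var_ideal_vanish (A : nzRingType) (theta : {rmorphism KL K L -> A}) S f :
  (forall g, basic_binomial g -> theta g = 0) ->
  (forall a, a \in S -> theta (var a) = 0) ->
  var_ideal pi S (pi f) -> theta f = 0.
Proof.
move=> tb tv /var_ideal_lift; move: f.
apply: (@ideal_gen_ind _ _ (fun f => theta f = 0)) => [|f g hf hg|f g gG].
- exact: rmorph0.
- by rewrite rmorphD hf hg addr0.
- by rewrite rmorphM; case: gG => [/tb->|[a /tv h ->]]; rewrite ?h mulr0.
Qed.

Lemma var_ideal_interval S u v f :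
  var_ideal pi S (pi f) -> interval_eval u v f != 0 ->
  exists2 s, s \in S & (u <= s <= v)%O.
Proof.
move=> Sf nz; have [/existsP[s /andP[]]|/existsPn no] :=
  boolP [exists s, (s \in S) && (u <= s <= v)%O]; first by exists s.
case/eqP: nz; apply: var_ideal_vanish Sf; first exact: interval_eval_binomial.
move=> a aS; rewrite /= interval_eval_var.
by have := no a; rewrite aS /= => /negbTE->.
Qed.

(** The one-point interval at [a] separates [a] from the other variables. *)
Lemma var_ideal_mem S a : var_ideal pi S (pi (var a)) -> a \in S.
Proof.
move/var_ideal_interval => /(_ a a); rewrite interval_eval_var lexx oner_neq0.
by case=> // s sS /andP[h1 h2]; rewrite (@le_anti _ _ a s) ?h1.
Qed.

Lemma var_ideal_var S a : a \in S -> var_ideal pi S (pi (var a)).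
Proof. by move=> aS; apply: ideal_gen_mem; exists a. Qed.

Lemma var_ideal_prod S a b : var_ideal pi S (pi (var a) * pi (var b)) ->
  exists2 s, s \in S & (a `&` b <= s <= a `|` b)%O.
Proof.
rewrite -rmorphM => /var_ideal_interval; apply.
by rewrite rmorphM /= !interval_eval_var leIl leUl leIr leUr mulr1 oner_neq0.
Qed.

(** The basic binomials are quadratic, so only the variables in [S] contribute linear terms. *)
Lemma var_ideal_lin S f : var_ideal pi S (pi f) ->
  meval (fun=> 0) f = 0 /\ forall c, c \notin S -> lin_coef c f = 0.
Proof.
move/var_ideal_lift; move: f; apply: ideal_gen_ind.
- by split=> [|c _]; rewrite ?meval0 // /lin_coef mderiv0 meval0.
- move=> f g [f0 fc] [g0 gc]; split=> [|c cS]; first by rewrite mevalD f0 g0 addr0.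
  by rewrite lin_coefD fc // gc // addr0.
move=> f g gG; have [g0 gc] : meval (fun=> 0) g = 0 /\
    forall c, c \notin S -> lin_coef c g = 0.
  case: gG => [[a [b [_ ->]]]|[a aS ->]]; split.
  - by rewrite mevalB !mevalM !meval0_var !mul0r subr0.
  - by move=> c _; rewrite lin_coefB !lin_coefM !meval0_var !mul0r !mulr0 addr0 subr0.
  - exact: meval0_var.
  - by move=> c cS; rewrite lin_coef_var; case: eqP cS aS => // -> /negbTE->.
by split=> [|c cS]; rewrite ?mevalM ?lin_coefM g0 ?gc // !mulr0 ?addr0.
Qed.

Lemma var_ideal_neq1 S : ~ var_ideal pi S 1.
Proof.
rewrite -(rmorph1 pi) => /var_ideal_lin[/eqP].
by rewrite meval1 oner_eq0.
Qed.

(* Linear parts: both [b] and [c] would be multiples of the linear part of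
   the generator of the quotient. *)
Lemma cyclic_quotient_var S T b c :
  cyclic_quotient (var_ideal pi S) (var_ideal pi T) ->
  b \in S -> b \notin T -> c \in S -> c \notin T -> b = c.
Proof.
case=> g Sg gen bS bT cS cT; have [g' eg] := proj1 pres g.
have [g0 _] : meval (fun=> 0) g' = 0 /\ forall c, c \notin S -> lin_coef c g' = 0.
  by apply: var_ideal_lin; rewrite eg.
(* As [g'] has no constant term, the linear part of a multiple of [g'] is a scalar multiple of that
   of [g']. *)
have lin a : a \in S ->
    exists k : K, forall e, e \notin T -> (a == e)%:R = k * lin_coef e g'.
  move=> aS; have [r] := gen _ (var_ideal_var aS); have [r' <-] := proj1 pres r.
  rewrite -eg -rmorphM -rmorphB => /var_ideal_lin[_ h].
  exists (meval (fun=> 0) r') => e eT; move/eqP: (h _ eT).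
  by rewrite lin_coefB lin_coef_var lin_coefM g0 mulr0 add0r subr_eq0 => /eqP.
have [k hk] := lin _ bS; have [l hl] := lin _ cS.
apply/eqP; apply: contraT => bc.
have /esym/eqP := hk _ cT; rewrite (negbTE bc) mulf_eq0 => /orP[] /eqP e0.
  by have /eqP := hk _ bT; rewrite eqxx e0 mul0r oner_eq0.
by have /eqP := hl _ cT; rewrite eqxx e0 mulr0 oner_eq0.
Qed.

End HibiRing.

(** After grouping by the value of [N], additivity of [F u] moves the sum over each fiber onto the
    coefficients. *)
Lemma big_fiber_eq0 (T U : eqType) (A B : zmodType) (F : U -> {additive A -> B})
    (s : seq T) (N : T -> U) (c : T -> A) :
  (forall u, \sum_(m <- s | N m == u) c m = 0) ->
  \sum_(m <- s) F (N m) (c m) = 0.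
Proof.
move=> c0; pose r := undup (map N s).
transitivity (\sum_(u <- r) \sum_(m <- s | N m == u) F (N m) (c m)).
  rewrite (exchange_big_dep xpredT) //= [LHS]big_seq [RHS]big_seq.
  apply: eq_bigr => m ms; rewrite -big_filter.
  rewrite (eq_filter (a2 := pred1 (N m))) => [|u]; last by rewrite /= eq_sym.
  by rewrite filter_pred1_uniq ?undup_uniq ?mem_undup ?map_f // big_seq1.
apply: big1 => u _; rewrite (eq_bigr (fun m => F u (c m))) => [|m /eqP-> //].
by rewrite -raddf_sum c0 raddf0.
Qed.

(** * Join-prime elements of a finite distributive lattice *)

Section JoinPrimes.
Variables (d : Order.disp_t) (L : finLatticeType d).
Implicit Types (a b c p x y z : L) (s t : seq L).
Local Open Scope order_scope.

(* A least element is join-prime in this sense; it records the degree. *)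
Definition join_prime p :=
  [forall x, forall y, (p <= x `|` y) ==> (p <= x) || (p <= y)].

Lemma join_primeU p x y : join_prime p -> (p <= x `|` y) = (p <= x) || (p <= y).
Proof.
move=> /forallP/(_ x)/forallP/(_ y)/implyP h; apply/idP/idP => // /orP[] h'.
  exact: lexUl.
exact: lexUr.
Qed.

Lemma join_prime_count p x y : join_prime p ->
  ((p <= x)%O + (p <= y)%O = (p <= x `|` y)%O + (p <= x `&` y)%O)%N.
Proof. by move=> pp; rewrite join_primeU // lexI; do 2![case: (p <= _)]. Qed.

Lemma join_prime_foldr p c s : join_prime p ->
  (p <= foldr Order.join c s) = has (>= p) (c :: s).
Proof.
by move=> pp; elim: s => [|e s IH] /=; rewrite ?orbF // join_primeU // IH orbCA.
Qed.

Lemma ex_bottom a : exists b, forall x, b <= x.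
Proof.
exists (foldr Order.meet a (enum L)) => x; have := mem_enum L x; rewrite inE.
elim: (enum L) => //= y s IH; rewrite inE => /orP[/eqP->|/IH h]; first exact: leIl.
exact: leIxr.
Qed.

Hypothesis distL : distributive_lattice L.

(** Birkhoff's argument: if [x] is not join-prime, some [c v e] lies above [x] while neither [c] nor
    [e] does. By distributivity [x] is the join of the smaller elements [x ^ c] and [x ^ e], and
    induction applies to both. *)
Lemma le_join_primes x y :
  (forall p, join_prime p -> p <= x -> p <= y) -> x <= y.
Proof.
have [n] := ubnP #|[set z | z <= x]|; elim: n x => // n IH x /ltnSE ltn h.
have [px|] := boolP (join_prime x); first exact: h.
case/forallPn=> c /forallPn[e]; rewrite negb_imply negb_or => /and3P[xce xc xe].
have low z : ~~ (x <= z) -> x `&` z <= y.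
  move=> xz; apply: IH => [|p pp pxz]; last first.
    by apply: h => //; apply: le_trans pxz (leIl _ _).
  apply: leq_trans ltn; apply/proper_card/properP; split.
    by apply/subsetP=> w; rewrite !inE => wxz; apply: le_trans wxz (leIl _ _).
  by exists x; rewrite !inE // lexI lexx.
by rewrite -(meet_idPl xce) distL leUx !low.
Qed.

End JoinPrimes.

(** * The filtration by down-sets of a distributive lattice *)

Section DistributiveFiltration.
Variables (K : fieldType) (d : Order.disp_t) (L : finLatticeType d).
Hypothesis distL : distributive_lattice L.
Implicit Types (a b c p x y z : L) (s t : seq L).

Local Notation var := (@var K d L).
Local Notation n := #|L|.

(** The target ring reuses the index set of K[L]; variables at elements that are not join-prime
    never occur. *)
Definition jp_mnm c : 'X_{1..n} :=
  [multinom (join_prime (enum_val i) && (enum_val i <= c)%O : nat) | i < n].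

Definition jp_mnms s : 'X_{1..n} := (\big[+%MM/0]_(c <- s) jp_mnm c)%MM.

Lemma jp_mnmsE s p : join_prime p -> jp_mnms s (enum_rank p) = count (>= p)%O s.
Proof.
move=> pp; rewrite mnm_sumE -sum1_count [RHS]big_mkcond; apply: eq_bigr => c _.
by rewrite mnmE enum_rankK pp /=; case: (p <= c)%O.
Qed.

Lemma jp_mnm_join_meet x y :
  (jp_mnm x + jp_mnm y = jp_mnm (x `|` y)%O + jp_mnm (x `&` y)%O)%MM.
Proof.
apply/mnmP => i; rewrite !mnmDE !mnmE.
by case: (boolP (join_prime _)) => //= /join_prime_count ->.
Qed.

(** Hibi's toric parametrization, cut off outside the principal filter of [a]. *)
Definition hibi_map a : KL K L -> {mpoly K[n]} :=
  mmap (@mpolyC n K)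
    (fun i => if (a <= enum_val i)%O then 'X_[jp_mnm (enum_val i)] else 0).
HB.instance Definition _ a := GRing.RMorphism.on (hibi_map a).

Lemma hibi_map_var a c :
  hibi_map a (var c) = if (a <= c)%O then 'X_[jp_mnm c] else 0.
Proof. by rewrite /hibi_map mmapX mmap1U enum_rankK. Qed.

Lemma hibi_mapZ a (k : K) f : hibi_map a (k *: f) = k *: hibi_map a f.
Proof. by rewrite -mul_mpolyC rmorphM /= {1}/hibi_map mmapC mul_mpolyC. Qed.

Lemma hibi_map_prod a s : hibi_map a (\prod_(c <- s) var c) =
  if all (>= a)%O s then 'X_[jp_mnms s] else 0.
Proof.
rewrite rmorph_prod /jp_mnms; elim: s => [|c s IH] /=.
  by rewrite !big_nil mpolyX0.
rewrite !big_cons IH hibi_map_var; case: (a <= c)%O; last by rewrite mul0r.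
by case: all => /=; rewrite ?mulr0 // mpolyXD.
Qed.

Lemma hibi_map_binomial a f : basic_binomial f -> hibi_map a f = 0.
Proof.
move=> [x [y [_ ->]]]; rewrite rmorphB !rmorphM /= !hibi_map_var lexI.
case: (boolP (a <= x)%O) => [ax|]; last by rewrite mul0r mulr0 subr0.
case: (a <= y)%O; last by rewrite !mulr0 subr0.
by rewrite (le_trans ax (leUl _ _)) -!mpolyXD jp_mnm_join_meet subrr.
Qed.

Definition mnm_seq (m : 'X_{1..n}) : seq L :=
  flatten [seq nseq (m i) (enum_val i) | i <- enum 'I_n].

Lemma mnm_seqE m : 'X_[m] = \prod_(c <- mnm_seq m) var c.
Proof.
rewrite mpolyXE_id big_flatten big_map /= big_enum.
by apply: eq_bigr => i _; rewrite big_nseq /Defs.var enum_valK iter_mulr_1.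
Qed.

Variables (R : comNzRingType) (pi : {rmorphism KL K L -> R}).
Hypothesis pres : hibi_presentation pi.

(* Straightening: the join of a nonempty product of variables can be split off. *)
Lemma pi_prod_join c s : exists2 t, size t = size s &
  \prod_(e <- c :: s) pi (var e) =
    pi (var (foldr Order.join c s)) * \prod_(e <- t) pi (var e) /\
  forall p, join_prime p ->
    count (>= p)%O (c :: s) = ((p <= foldr Order.join c s)%O + count (>= p)%O t)%N.
Proof.
elim: s => [|e s [t szt [tE tc]]].
  by exists [::] => //; split=> //; rewrite !big_cons big_nil.
pose j := foldr Order.join c s; exists ((e `&` j)%O :: t); first by rewrite /= szt.
split=> [|p pp].
  rewrite big_cons in tE; rewrite !big_cons mulrCA tE !mulrA /= -/j.
  by rewrite (pi_join_meet pres).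
have /= := tc p pp; rewrite -/j => h.
by rewrite addnCA h !addnA -(join_prime_count e j pp).
Qed.

(** The counts tell which join-primes lie below the join of all entries, hence determine that join.
    Splitting it off both products leaves shorter ones with equal counts. *)
Lemma pi_prod_eq s t : size s = size t ->
  (forall p, join_prime p -> count (>= p)%O s = count (>= p)%O t) ->
  \prod_(c <- s) pi (var c) = \prod_(c <- t) pi (var c).
Proof.
move sz : (size s) => k; elim: k s t sz => [|k IH] [|c s] [|e t] //= [sz] [szt] st.
have [s' szs' [-> cs]] := pi_prod_join c s.
have [t' szt' [-> ct]] := pi_prod_join e t.
have le p : join_prime p ->
    (p <= foldr Order.join c s)%O = (p <= foldr Order.join e t)%O.
  by move=> pp; rewrite !join_prime_foldr // !has_count /= st.
have -> : foldr Order.join c s = foldr Order.join e t.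
  by apply/le_anti/andP; split; apply: le_join_primes => // p pp; rewrite le.
congr (_ * _); apply: IH => [||p pp]; rewrite ?szs' ?szt' //.
by apply/eqP; rewrite -(eqn_add2l (p <= foldr Order.join c s)%O) -cs // le // -ct //= st.
Qed.

Lemma pi_mnm_eq m m' : jp_mnms (mnm_seq m) = jp_mnms (mnm_seq m') ->
  pi 'X_[m] = pi 'X_[m'].
Proof.
(* If [L] is empty, there is only one monomial. *)
have [c0 _|no _] := pickP (@predT L); last first.
  by congr (pi 'X_[_]); apply/mnmP => i; have := no (enum_val i).
move=> /mnmP mm'; rewrite !mnm_seqE !rmorph_prod; have [b bP] := ex_bottom c0.
have cE p : join_prime p -> count (>= p)%O (mnm_seq m) = count (>= p)%O (mnm_seq m').
  by move=> pp; rewrite -!jp_mnmsE.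
(* The least element [b] is join-prime and below every entry, so its count is the length. *)
apply: pi_prod_eq => //; have := cE b.
rewrite !(eq_count (a2 := predT)) ?count_predT; last 2 first.
- by move=> x; rewrite /= bP.
- by move=> x; rewrite /= bP.
by apply; apply/forallP => x; apply/forallP => y; rewrite !bP.
Qed.

(** Monomials with a variable not above [a] lie in the ideal. Among the others, those with the same
    image under [hibi_map a] are equal in [R], and their coefficients add up to a coefficient of
    [hibi_map a f]. *)
Lemma hibi_map_ker a f :
  hibi_map a f = 0 -> var_ideal pi [set c | ~~ (a <= c)%O] (pi f).
Proof.
move=> f0; pose good m := all (>= a)%O (mnm_seq m).
pose F (u : 'X_{1..n}) (m : 'X_{1..n}) := good m && (jp_mnms (mnm_seq m) == u).
rewrite [f in pi f]mpolyE rmorph_sum (bigID good) /=.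
apply: ideal_genD; last first.
  apply: ideal_gen_sum => m _ /allPn[c cm ac].
  rewrite -mul_mpolyC rmorphM mnm_seqE rmorph_prod (big_rem c) //= mulrCA mulrC.
  by apply: ideal_gen_mulg; exists c; rewrite ?inE.
suff -> : \sum_(m <- msupp f | good m) pi (f@_m *: 'X_[m]) = 0 by exact: ideal_gen0.
(* The first good monomial of [f] with image exponent [u] represents its class; the default is
   reached only when there is none. *)
pose tau u := pi 'X_[nth 0%MM (filter (F u) (msupp f)) 0].
pose G u := (fun k : K => pi k%:MP * tau u).
have Ga u : zmod_morphism (G u).
  by move=> k l; rewrite /G rmorphB rmorphB mulrBl.
pose Gu u : {additive K -> R} := HB.pack (G u) (GRing.isZmodMorphism.Build _ _ _ (Ga u)).
rewrite -big_filter.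
transitivity (\sum_(m <- filter good (msupp f)) Gu (jp_mnms (mnm_seq m)) f@_m).
  rewrite big_seq [RHS]big_seq; apply: eq_bigr => m.
  rewrite mem_filter => /andP[gm ms] /=.
  rewrite /G -mul_mpolyC rmorphM; congr (_ * _); apply: pi_mnm_eq.
  set l := filter _ _; have : nth 0%MM l 0 \in l.
    apply: mem_nth; rewrite size_filter -has_count; apply/hasP; exists m => //.
    by rewrite /F gm eqxx.
  by rewrite mem_filter => /andP[/andP[_ /eqP->]].
apply: big_fiber_eq0 => u; rewrite big_filter_cond.
have := congr1 (mcoeff u) f0.
rewrite mcoeff0 {1}[f]mpolyE rmorph_sum raddf_sum /= => E; rewrite -[RHS]E.
rewrite [LHS]big_mkcond; apply: eq_bigr => m _.
rewrite hibi_mapZ mcoeffZ mnm_seqE hibi_map_prod -/(good m).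
case: (good m) => /=; last by rewrite mcoeff0 mulr0.
by rewrite mcoeffX; case: eqP; rewrite (mulr1, mulr0).
Qed.

(** [hibi_map a] kills the ideal of [S] but sends [a] to a nonzero monomial of a domain, so it kills
    any lift of [r]. *)
Lemma var_ideal_colon (S : {set L}) a r : (forall s : L, s \in S -> ~~ (a <= s)%O) ->
  var_ideal pi S (r * pi (var a)) -> var_ideal pi [set c | ~~ (a <= c)%O] r.
Proof.
move=> Sa; have [f <-] := proj1 pres r; rewrite -rmorphM.
move=> /(var_ideal_vanish pres (theta := hibi_map a)) h; apply: hibi_map_ker.
have /eqP : hibi_map a (f * var a) = 0.
  apply: h => [g|s /Sa sa]; first exact: hibi_map_binomial.
  by rewrite /= hibi_map_var (negbTE sa).
rewrite rmorphM /= hibi_map_var lexx mulf_eq0 => /orP[/eqP //|].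
by move/eqP/(congr1 (mcoeff (jp_mnm a)))/eqP; rewrite mcoeffX eqxx mcoeff0 oner_eq0.
Qed.

Lemma max_graded_idealE : same_ideal (max_graded_ideal pi) (var_ideal pi setT).
Proof.
move=> r; split; apply: ideal_gen_sub => g.
  case=> p /dhomogP hp ->; rewrite (mpolyE p) rmorph_sum.
  apply: ideal_gen_sum => m /hp /= /eqP; rewrite mdeg_eq1 => /existsP[i /eqP->] _.
  rewrite -mul_mpolyC rmorphM; apply: ideal_gen_mulg.
  exists (enum_val i); rewrite ?inE //.
  by rewrite /Defs.var enum_valK.
case=> a _ ->; apply: ideal_gen_mem; exists (var a) => //.
by rewrite /Defs.var dhomogX /= mdeg1.
Qed.

Lemma distributive_koszul_filtration :
  exists F : (R -> Prop) -> Prop, combinatorial_koszul_filtration pi F.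
Proof.
pose down (S : {set L}) := forall x y : L, y \in S -> (x <= y)%O -> x \in S.
pose F I := exists2 S : {set L}, down S & same_ideal I (var_ideal pi S).
have Fv S : down S -> F (var_ideal pi S) by move=> dS; exists S.
exists F; split; last by move=> I [S _ IS]; exists S.
split.
- move=> I [S _ IS]; exists (fun r => exists2 a, a \in S & r = pi (var a)).
  split=> // r [a _ ->]; exists (var a) => //.
  by rewrite /Defs.var dhomogX /= mdeg1.
- exists (var_ideal pi set0); first by apply: Fv => x y; rewrite inE.
  move=> r; split=> [|->]; last exact: ideal_gen0.
  move: r; apply: ideal_gen_ind => // [r s -> ->|r g [a]]; first exact: addr0.
  by rewrite inE.
- exists (var_ideal pi setT); first by apply: Fv => x y; rewrite !inE.
  by move=> r; split=> /max_graded_idealE.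
move=> I [S dS IS] nz.
have [a0 a0S|S0] := pickP (mem S); last first.
  case: nz => r; split=> [/IS|->]; last exact/IS/ideal_gen0.
  move: r; apply: ideal_gen_ind => // [r s -> ->|r g [a aS]]; first exact: addr0.
  by have := S0 a; rewrite /= aS.
(* An element of [S] with the largest principal down-set is maximal in [S]. *)
case: (arg_maxnP (fun a => #|[set z | (z <= a)%O]|) a0S) => a aS amax.
have Sa (s : L) : s \in S :\ a -> ~~ (a <= s)%O.
  rewrite !inE => /andP[sa sS]; apply/negP=> le; case/negP: sa; apply/eqP.
  apply/le_anti; rewrite le andbT; apply: contraT => nsa.
  have /negP[] : ~~ (#|[set z | (z <= a)%O]| < #|[set z | (z <= s)%O]|)%N.
    by rewrite -leqNgt; exact: amax.
  apply/proper_card/properP; split; last by exists s; rewrite !inE.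
  by apply/subsetP=> z; rewrite !inE => za; apply: le_trans le.
exists (var_ideal pi (S :\ a)).
  apply: Fv => x y; rewrite !inE => /andP[ya yS] xy; rewrite (dS _ _ yS xy) andbT.
  apply/eqP=> xa; have /Sa : y \in S :\ a by rewrite !inE ya.
  by rewrite -xa xy.
split.
- move=> r h; apply/IS; move: h; apply: ideal_gen_sub => g [s].
  by rewrite !inE => /andP[_ sS] ->; exact: var_ideal_var.
- exists (pi (var a)); first exact/IS/var_ideal_var.
  move=> x /IS; move: x; apply: ideal_gen_ind.
  + by exists 0; rewrite mul0r subr0; exact: ideal_gen0.
  + move=> r s [r' hr] [s' hs]; exists (r' + s').
    by rewrite mulrDl opprD addrACA; exact: ideal_genD.
  move=> r g [b bS ->]; have [->|ba] := eqVneq b a.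
    by exists r; rewrite subrr; exact: ideal_gen0.
  exists 0; rewrite mul0r subr0; apply: ideal_gen_mulg; exists b => //.
  by rewrite !inE ba.
- exists (var_ideal pi [set c | ~~ (a <= c)%O]).
    apply: Fv => x y; rewrite !inE => ay xy; apply: contra ay => ax.
    exact: le_trans xy.
  move=> r; split=> [hr x /IS|hr].
    move: x; apply: ideal_gen_ind => [|x y|x g [b bS ->]].
    + by rewrite mulr0; exact: ideal_gen0.
    + by rewrite mulrDr; exact: ideal_genD.
    rewrite mulrCA; apply: ideal_genM.
    have [->|ba] := eqVneq b a; last first.
      by apply/ideal_gen_mulg; exists b; rewrite // !inE ba.
    move: r hr; apply: ideal_gen_ind => [|r s|r h [c]].
    + by rewrite mul0r; exact: ideal_gen0.
    + by rewrite mulrDl; exact: ideal_genD.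
    (* Here [c ^ a] lies in the down-set [S] and differs from [a], since [c] is not above [a]. *)
    rewrite inE => ac ->; rewrite -mulrA (pi_join_meet pres) mulrA.
    apply: ideal_gen_mulg; exists (c `&` a)%O => //.
    rewrite !inE (dS _ _ aS (leIr _ _)) andbT; apply: contra ac => /eqP/meet_idPr.
    by [].
  by apply: var_ideal_colon Sa _; apply: hr; exact/IS/var_ideal_var.
Qed.

End DistributiveFiltration.

(** * From a combinatorial Koszul filtration to distributivity *)

Section FiltrationDistributive.
Variables (K : fieldType) (d : Order.disp_t) (L : finLatticeType d).
Variables (R : comNzRingType) (pi : {rmorphism KL K L -> R}).
Hypotheses (modL : modular_lattice L) (pres : hibi_presentation pi).

Local Notation var := (@var K d L).

(* If [u] is the first variable of [u, v] to be adjoined, then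
   [u v x = x y z = u v y] forces [v x] into the colon ideal; dually for [v].
   An inner [b] has two complements [y], [z], and then [b y = b z]. *)
Lemma minimal_two_compl_colon (u v b : L) (S S' T : {set L}) :
  minimal_two_compl u v -> b \in S -> (u <= b <= v)%O ->
  (forall s, s \in S' -> ~~ (u <= s <= v)%O) ->
  cyclic_quotient (var_ideal pi S) (var_ideal pi S') ->
  same_ideal (var_ideal pi T) (colon_ideal (var_ideal pi S') (var_ideal pi S)) ->
  False.
Proof.
move=> hm bS /andP[ub bv] S'uv cyc colT.
(* For [t] in [T] the product of [t] and [b] is in the ideal of [S'], so [S'] meets the interval
   from [t ^ b] to [t v b]. *)
have TN t : t \in T -> ~~ (u <= t <= v)%O.
  move=> tT; apply/negP=> /andP[ut tv].
  have [s sS' /andP[h1 h2]] : exists2 s, s \in S' & (t `&` b <= s <= t `|` b)%O.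
    apply: (var_ideal_prod pres); apply: (proj1 (colT _)) (var_ideal_var _ tT) _ _.
    exact: var_ideal_var.
  case/negP: (S'uv s sS'); apply/andP; split.
    by apply: le_trans h1; lattice_le.
  by apply: le_trans h2 _; lattice_le.
(* Since the quotient is cyclic, [b] is the only element of [S] outside [S'], so whatever kills [b]
   lies in the colon ideal. *)
have annT f : f * pi (var b) = 0 -> var_ideal pi T f.
  move=> f0; apply: (proj2 (colT _)).
  apply: ideal_gen_ind => [|r s|r g [a aS ->]].
  - by rewrite mulr0; exact: ideal_gen0.
  - by rewrite mulrDr; exact: ideal_genD.
  have [aS'|aS'] := boolP (a \in S').
    by rewrite mulrA; apply/ideal_genM/var_ideal_var.
  have bS' : b \notin S' by apply/negP => /S'uv; rewrite ub bv.
  rewrite (cyclic_quotient_var pres cyc aS aS' bS bS') mulrCA f0 mulr0.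
  exact: ideal_gen0.
have noT w t f : f * pi (var b) = 0 -> (u <= w)%O -> (t <= v)%O ->
    forall p, f = pi p -> interval_eval w t p != 0 -> False.
  move=> f0 uw tv p fp nz; move/annT: f0; rewrite fp => /(var_ideal_interval pres).
  move=> /(_ w t nz) [s /TN/negP h /andP[ws st]]; apply: h.
  by rewrite (le_trans uw ws) (le_trans st tv).
have [x [y [z [xy cxy cxz cyz]]]] := minimal_two_compl_diamond modL hm.
have [ux xv uy yv] := rel_compl_bounds cxy; have [_ _ uz zv] := rel_compl_bounds cxz.
have prodE p q : rel_compl u v p q ->
    pi (var p) * pi (var q) = pi (var v) * pi (var u).
  by case=> <- <-; rewrite (pi_join_meet pres).
have xyz : pi (var v) * pi (var u) * pi (var x) = pi (var v) * pi (var u) * pi (var y).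
  by rewrite -{1}(prodE _ _ cyz) -(prodE _ _ cxz) mulrC mulrA mulrAC.
have nxy : ~~ (x <= y)%O.
  apply/negP=> h; apply: xy.
  exact: (rel_compl_le_eq modL (rel_complC cxz) (rel_complC cyz) h).
have nyx : ~~ (y <= x)%O.
  apply/negP=> h; apply: xy; apply/esym.
  exact: (rel_compl_le_eq modL (rel_complC cyz) (rel_complC cxz) h).
case: (eqVneq b u) => [bu|nbu].
  (* The interval from [x] to [v] contains [v] and [x] but not [y], so this element takes the value
     1. *)
  apply: (noT x v (pi (var v * (var x - var y))) _ ux (lexx v) _ erefl).
    apply/eqP; rewrite bu rmorphM rmorphB mulrAC mulrBr subr_eq0.
    exact/eqP.
  rewrite rmorphM rmorphB /= !interval_eval_var lexx xv yv lexx (negbTE nxy) /=.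
  by rewrite subr0 mulr1 oner_neq0.
case: (eqVneq b v) => [bv'|nbv].
  apply: (noT u x (pi (var u * (var x - var y))) _ (lexx u) xv _ erefl).
    apply/eqP; rewrite bv' rmorphM rmorphB mulrAC mulrBr subr_eq0.
    by rewrite [pi (var u) * _]mulrC; exact/eqP.
  rewrite rmorphM rmorphB /= !interval_eval_var lexx ux uy lexx (negbTE nyx) /=.
  by rewrite subr0 mulr1 oner_neq0.
have [||p [q [pq cp cq]]] := minimal_two_compl_inner (b := b) modL hm.
- by rewrite lt_neqAle eq_sym nbu.
- by rewrite lt_neqAle nbv.
have [_ _ up pv] := rel_compl_bounds cp.
apply: (noT p p (pi (var p - var q)) _ up pv _ erefl).
  by apply/eqP; rewrite rmorphB mulrC mulrBr (prodE _ _ cp) (prodE _ _ cq) subrr.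
rewrite rmorphB /= !interval_eval_var lexx -eq_le.
by move/eqP/negbTE: pq => ->; rewrite subr0 oner_neq0.
Qed.

Lemma koszul_filtration_distributive (F : (R -> Prop) -> Prop) :
  combinatorial_koszul_filtration pi F -> distributive_lattice L.
Proof.
move=> [[_ _ [M FM Mm] step] Fvar] a0 b0 c0; apply/eqP; apply: contraT => /eqP.
move=> /(nondistributive_two_compl modL)[u0 [v0]].
move=> /exists_minimal_two_compl[u [v hm]]; exfalso.
(* Descend from the maximal ideal, by induction on the number of variables, until the next set [S']
   misses the interval. *)
suff no n (S : {set L}) I b : (#|S| < n)%N -> F I -> same_ideal I (var_ideal pi S) ->
    b \in S -> (u <= b <= v)%O -> False.
  have [S SM] := Fvar _ FM.
  apply: (no #|S|.+1 S M u) => //.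
    apply: (var_ideal_mem pres); apply/(SM _)/(Mm _)/ideal_gen_mem.
    by exists (var u) => //; rewrite /Defs.var dhomogX /= mdeg1.
  rewrite lexx /=; case: hm => -[a [x [y [_ [<- <-] _]]]] _; lattice_le.
elim: n S I b => // n IH S I b ltS FI IS bS buv.
have [|J FJ [JI cyc [C FC CJI]]] := step I FI.
  move=> I0; have /IS/I0 e0 := var_ideal_var pi bS.
  suff : b \in set0 by rewrite inE.
  by apply: (var_ideal_mem pres); rewrite e0; exact: ideal_gen0.
have [S' JS'] := Fvar _ FJ; have [T CT] := Fvar _ FC.
have colT : same_ideal (var_ideal pi T)
    (colon_ideal (var_ideal pi S') (var_ideal pi S)).
  move=> r; split=> [/CT/CJI h x /IS/h/JS'//|h].
  by apply/CT/CJI => x /IS/h/JS'.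
have S'S : S' \subset S.
  apply/subsetP=> s sS'; apply: (var_ideal_mem pres).
  by apply/(IS _)/JI/(JS' _)/var_ideal_var.
apply: (minimal_two_compl_colon hm bS buv _ _ colT) => [s sS'|].
  apply/negP=> suv; apply: (IH S' J s) => //.
  rewrite -ltnS; apply: leq_trans ltS; rewrite ltnS.
  apply: proper_card; rewrite properEneq S'S andbT; apply/eqP => eS.
  (* If [S' = S], the colon ideal contains 1, which no ideal generated by variables does. *)
  apply: (var_ideal_neq1 pres (S := T)); apply/colT => x.
  by rewrite mul1r eS.
case: cyc => g Ig gen; exists g; first exact/IS.
by move=> x /IS/gen[r Jr]; exists r; exact/JS'.
Qed.

End FiltrationDistributive.

Theorem theorem2p4 (K : fieldType) (d : Order.disp_t) (L : finLatticeType d)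
  (R : comRingType) (pi : {rmorphism KL K L -> R}) :
  modular_lattice L ->
  hibi_presentation pi ->
  (distributive_lattice L <->
   exists F : (R -> Prop) -> Prop, combinatorial_koszul_filtration pi F).
Proof.
move=> modL pres; split=> [distL|[F]].
  exact: distributive_koszul_filtration.
exact: koszul_filtration_distributive.
Qed.
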